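(* Let $n \ge 2$ be an integer and let $S_n$ be the star with center $0$ and leaves $1,\dots,n$. Then the domination number of the $2$-token graph of $S_n$ satisfies \[\gamma(F_2(S_n)) = n-1.\]
   Context: For a simple graph $G$ and an integer $k$ with $1 \le k \le |V(G)|-1$, the $k$-token graph $F_k(G)$ is the graph whose vertices are the $k$-element subsets of $V(G)$, two of them being adjacent if and only if their symmetric difference is a pair $\{u,v\}$ with $uv$ an edge of $G$. The star $S_n$ has vertex set $\{0\}\cup\{1,\dots,n\}$ and edges $\{0,i\}$ for $1\le i\le n$. A dominating set of a graph $H$ is a set $D\subseteq V(H)$ such that every vertex of $H$ is in $D$ or has a neighbor in $D$; the domination number $\gamma(H)$ is the minimum size of a dominating set. *)

(* Defs.v *)
From HB Require Import structures.
From mathcomp Require Import all_boot.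

Set Implicit Arguments.
Unset Strict Implicit.
Unset Printing Implicit Defensive.

Record sgraph := SGraph {
  vertex :> finType;
  edge : rel vertex;
  edge_sym : symmetric edge;
  edge_irrefl : irreflexive edge
}.

Section Domination.
Variable H : sgraph.

Definition dominating (D : {set H}) : bool :=
  [forall x : H, (x \in D) || [exists y in D, edge x y]].

Lemma dominating_setT : dominating [set: H].
Proof. by apply/forallP => x; rewrite inE. Qed.

Definition domination_number : nat :=
  #|[arg min_(D < [set: H] | dominating D) #|D|]|.

Lemma domination_numberP :
  (exists2 D : {set H}, dominating D & #|D| = domination_number) /\
  (forall D : {set H}, dominating D -> domination_number <= #|D|).
Proof.
rewrite /domination_number; case: arg_minnP; first exact: dominating_setT.
by move=> D domD minD; split; [exists D | ].
Qed.

End Domination.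

Section TokenGraph.
Variables (k : nat) (G : sgraph).

Definition sym_diff (A B : {set G}) : {set G} := (A :\: B) :|: (B :\: A).

Definition token_vertex : finType := {A : {set G} | #|A| == k}.

Definition token_edge : rel token_vertex := fun A B =>
  [exists u : G, exists v : G,
     edge u v && (sym_diff (val A) (val B) == [set u; v])].

Lemma token_edge_sym : symmetric token_edge.
Proof. by move=> A B; rewrite /token_edge /sym_diff setUC. Qed.

Lemma token_edge_irrefl : irreflexive token_edge.
Proof.
move=> A; apply/negbTE/existsP => -[u /existsP[v /andP[_ /eqP/setP/(_ u)]]].
by rewrite /sym_diff setDv setU0 !inE eqxx.
Qed.

(* The definition makes sense for every k; the usual range is
   1 <= k <= #|G| - 1. *)
Definition token_graph : sgraph := SGraph token_edge_sym token_edge_irrefl.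

End TokenGraph.

Section Star.
Variable n : nat.

Definition star_edge : rel 'I_n.+1 := fun u v =>
  ((u == ord0) && (v != ord0)) || ((u != ord0) && (v == ord0)).

Lemma star_edge_sym : symmetric star_edge.
Proof. by move=> u v; rewrite /star_edge orbC andbC [X in _ || X]andbC. Qed.

Lemma star_edge_irrefl : irreflexive star_edge.
Proof. by move=> u; rewrite /star_edge andbN andNb. Qed.

Definition star : sgraph := SGraph star_edge_sym star_edge_irrefl.

End Star.

(* Main.v *)
(* In F_2(S_n) the only neighbours of a pair of leaves {i,j} are {0,i} and
   {0,j}.  Hence, for leaves a and b, the pair {a,b} together with the sets
   {0,i}, i <> a, b, dominates.  Conversely, let D be dominating and choose a
   leaf u with {0,u} not in D, or any leaf if there is none.  For every leaf
   i <> u, D contains {0,i} or {u,i}, and these n - 1 sets are distinct. *)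
Require Import Defs.
From HB Require Import structures.
From mathcomp Require Import all_boot.

(** The token on the center slides to [j] while [i] stays: the symmetric difference is [{0, j}], an
    edge of the star. *)
Lemma star_token_edge (n : nat) (A B : token_vertex 2 (star n))
    (i j : 'I_n.+1) :
    j != ord0 -> i != ord0 -> i != j ->
    val A = [set ord0; i] -> val B = [set i; j] -> token_edge A B.
Proof.
move=> j0 i0 ij eA eB; apply/existsP; exists ord0; apply/existsP; exists j.
rewrite /= /star_edge eqxx j0 /= /sym_diff eA eB; apply/eqP/setP => x.
rewrite !inE; have [->|x0] := eqVneq x ord0.
  by rewrite !(eq_sym ord0) (negPf i0) (negPf j0).
have [->|xi] := eqVneq x i; first by rewrite (negPf ij).
by case: (x == j).
Qed.

(** Every edge of the star contains the center, which [A] lacks, so [B] gains it. As [B] has two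
    elements, it keeps exactly one leaf of [A]. *)
Lemma star_token_edge_leaves (n : nat) (A B : token_vertex 2 (star n))
    (i j : 'I_n.+1) :
    i != ord0 -> j != ord0 -> i != j ->
    val A = [set i; j] -> token_edge A B ->
  val B = [set ord0; i] \/ val B = [set ord0; j].
Proof.
move=> i0 j0 ij eA /existsP[u /existsP[v /andP[uv /eqP eD]]].
have {u v uv eD} [w eD] : exists w, sym_diff (val A) (val B) = [set ord0; w].
  by case/orP: uv => /andP[/eqP ? /eqP ?]; [exists v | exists u];
     rewrite eD; subst; rewrite // setUC.
(* [B] is recovered from [A] by toggling [0] and [w]. *)
have mem x : (x \in val B) = (x \in [set i; j]) (+) (x \in [set ord0; w]).
  by rewrite -eD /sym_diff eA !inE; do 2!case: (_ == _); case: (_ \in _).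
have B0 : ord0 \in val B.
  by rewrite mem !inE eqxx !(eq_sym ord0) (negPf i0) (negPf j0).
have cB : #|val B| = 2 by apply/eqP; exact: (valP B).
have eqB x : x != ord0 -> x \in val B -> val B = [set ord0; x].
  move=> x0 xB; apply/esym/eqP; rewrite eqEcard cB cards2 eq_sym x0 andbT.
  by apply/subsetP => y; rewrite !inE => /orP[]/eqP->.
(* If [w = i], the leaf [j] survives; otherwise [i] does. *)
have [wi|wi] := eqVneq w i; [right | left]; apply: eqB => //; rewrite mem !inE.
  by rewrite eqxx orbT (negPf j0) wi eq_sym (negPf ij).
by rewrite eqxx (negPf i0) (eq_sym i w) (negPf wi).
Qed.

Lemma star_token_dominating_card_le (n : nat) (hn : 2 <= n) :
  exists2 D : {set token_graph 2 (star n)}, dominating D & #|D| <= n - 1.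
Proof.
(* As [2 <= n], both values are in range, so [inord] does not fall back to the center. *)
pose a : 'I_n.+1 := inord 1; pose b : 'I_n.+1 := inord 2.
have a0 : a != ord0 by rewrite -val_eqE /= inordK // ltnS ltnW.
have b0 : b != ord0 by rewrite -val_eqE /= inordK.
have ab : a != b by rewrite -val_eqE /= !inordK // ltnS ltnW.
pose L := ~: [set ord0; a; b].
(* [S] consists of plain subsets, which avoids cardinality proofs; [D] is its preimage under [val].
   The bound is [1 + (n - 2)], since [L] has [n - 2] leaves. *)
pose S : {set {set star n}} := [set a; b] |: [set [set ord0; i] | i in L].
pose D : {set token_graph 2 (star n)} :=
  [set x : token_vertex 2 (star n) | val x \in S].
have in_ab x : x != ord0 -> x \notin L -> x \in [set a; b].
  by rewrite !inE negbK => /negPf->.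
have token (x y : 'I_n.+1) : x != y -> #|[set x; y] : {set star n}| == 2.
  by move=> xy; rewrite cards2 xy.
pose Tab : token_vertex 2 (star n) :=
  exist (fun A : {set star n} => #|A| == 2) _ (token a b ab).
have TabD : Tab \in D by rewrite !inE /= eqxx.
exists D; last first.
  have cS : #|S| <= n - 1.
    have cL : #|L| = n - 2.
      rewrite cardsCs setCK card_ord setUC cardsU1 cards2 !inE.
      by rewrite (negPf b0) eq_sym (negPf ab) (eq_sym ord0) a0.
    apply: leq_trans (leq_card_setU _ _) _; rewrite cards1.
    by rewrite -(subnSK hn) add1n ltnS -cL leq_imset_card.
  apply: leq_trans cS.
  rewrite -(card_imset D (val_inj : injective (val : token_vertex 2 (star n) -> _))).
  by apply/subset_leq_card/subsetP => _ /imsetP[x + ->]; rewrite inE.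
apply/forallP => x; apply/orP.
have /cards2P[i [j [ij ex]]] : #|val (x : token_vertex 2 (star n))| == 2.
  exact: (valP (x : token_vertex 2 (star n))).
(* Here [{0, k}] is the dominating neighbor. *)
have leaf_case (k l : 'I_n.+1) : val x = [set k; l] -> k != l -> k != ord0 ->
    l != ord0 -> k \in L -> [exists y in D, edge x y].
  move=> {}ex kl k0 l0 kL; have k0' : ord0 != k by rewrite eq_sym.
  apply/existsP.
  exists (exist (fun A : {set star n} => #|A| == 2) _ (token _ _ k0')).
  apply/andP; split.
    by rewrite !inE /=; apply/orP; right; apply: imset_f.
  by rewrite edge_sym; apply: (@star_token_edge _ _ _ k l).
have center_case (k : 'I_n.+1) : val x = [set ord0; k] -> k != ord0 ->
    x \in D \/ [exists y in D, edge x y].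
  move=> {}ex k0; case: (boolP (k \in L)) => [kL|/(in_ab _ k0)].
    by left; rewrite inE ex; apply/setU1P; right; apply: imset_f.
  rewrite !inE => kab; right; apply/existsP; exists Tab; rewrite TabD /=.
  case/orP: kab => /eqP ek; rewrite ek in ex.
    exact: (@star_token_edge _ _ _ a b).
  by apply: (@star_token_edge _ _ _ b a) => //=; rewrite 1?eq_sym // setUC.
have [i0|i0] := eqVneq i ord0.
  by apply: (center_case j); [rewrite ex i0 | rewrite eq_sym -i0].
have [j0|j0] := eqVneq j ord0.
  by apply: (center_case i); [rewrite ex j0 setUC | ].
case: (boolP (i \in L)) => iL; first by right; apply: (leaf_case i j).
case: (boolP (j \in L)) => jL.
  by right; apply: (leaf_case j i) => //; [rewrite ex setUC | rewrite eq_sym].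
(* Both leaves now lie in [{a, b}], so the pair is [{a, b}] itself. *)
left; rewrite inE; apply/setU1P; left; apply/eqP.
rewrite eqEcard ex !cards2 ab ij andbT; apply/subsetP => y.
by rewrite in_set2 => /orP[]/eqP->; apply: in_ab.
Qed.

Lemma star_token_dominating_card_ge (n : nat) (hn : 0 < n)
    (D : {set token_graph 2 (star n)}) :
  dominating D -> n - 1 <= #|D|.
Proof.
move=> /forallP domD.
pose S : {set {set star n}} :=
  [set val x | x : token_vertex 2 (star n) in (D : {set token_vertex 2 (star n)})].
have cS : #|S| = #|D| by apply: card_imset; exact: val_inj.
(* This covers both choices of [u]: the implication is vacuous if [{0, u}] is missing from [S], and
   otherwise all [{0, i}] belong to [S]. *)
have [u u0 uP] : exists2 u : 'I_n.+1, u != ord0 &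
    forall i : 'I_n.+1, i != ord0 -> [set ord0; u] \in S -> [set ord0; i] \in S.
  case: (pickP [pred u : 'I_n.+1 | (u != ord0) && ([set ord0; u] \notin S)]).
    by move=> u /andP[u0 uS]; exists u => // i _; rewrite (negPf uS).
  move=> allS; exists (inord 1) => [|i i0 _].
    by rewrite -val_eqE /= inordK // ltnS.
  by have := allS i; rewrite /= i0 /= => /negbFE.
pose f (i : 'I_n.+1) : {set star n} :=
  if [set ord0; i] \in S then [set ord0; i] else [set u; i].
pose L : {set 'I_n.+1} := ~: [set ord0; u].
have cL : #|L| = n - 1.
  by rewrite cardsCs setCK card_ord cards2 eq_sym u0.
(* Besides [j], the set [f j] contains only [0] or [u], so [i] in [f j] forces [i = j]. *)
have f_inj : {in L &, injective f}.
  move=> i j; rewrite !inE !negb_or => /andP[i0 iu] _ eij.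
  have : i \in f j by rewrite -eij /f; case: ifP; rewrite !inE eqxx orbT.
  by rewrite /f; case: ifP => _; rewrite !inE ?(negPf i0) ?(negPf iu) => /eqP.
rewrite -cS -cL -(card_in_imset f_inj); apply: subset_leq_card.
apply/subsetP => _ /imsetP[i + ->].
rewrite !inE negb_or /f => /andP[i0 iu]; case: ifP => // /negP iS.
(* With [{0, i}] not in [S], the pair [{u, i}] must itself be in [D]: a neighbor in [D] would be
   [{0, i}], or [{0, u}], which brings in [{0, i}] by [uP]. *)
have card_ui : #|[set u; i] : {set star n}| == 2 by rewrite cards2 (eq_sym u) iu.
pose x : token_vertex 2 (star n) :=
  exist (fun A : {set star n} => #|A| == 2) _ card_ui.
case/orP: (domD x) => [xD|/existsP[y /andP[yD xy]]].
  by apply/imsetP; exists x.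
have yS : val (y : token_vertex 2 (star n)) \in S by apply: imset_f.
have ui : u != i by rewrite eq_sym.
have [ey|ey] := star_token_edge_leaves _ _ _ _ _ u0 i0 ui (erefl (val x)) xy;
  rewrite ey in yS.
- by case: iS; apply: uP.
- by case: iS.
Qed.

Theorem theorem3p1 (n : nat) (hn : 2 <= n) :
  domination_number (token_graph 2 (star n)) = n - 1.
Proof.
have [[D domD eD] minD] := domination_numberP (token_graph 2 (star n)).
apply/eqP; rewrite eqn_leq; apply/andP; split.
  have [E domE cE] := star_token_dominating_card_le n hn.
  exact: leq_trans (minD _ domE) cE.
by rewrite -eD; apply: star_token_dominating_card_ge => //; apply: ltnW.
Qed.
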